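(* Let $R$ be a principal ideal domain which is not a field, and let $M$ be a left torsion $R$-module. Then $M$ has a proper essential submodule if and only if $\mathrm{Ann}_M(p^i)\subsetneq\mathrm{Ann}_M(p^j)$ for some prime $p\in R$ and some positive integers $i,j$ with $i<j$.
   Context: A proper essential submodule of a module $M$ is a submodule $E$ of $M$ with $E\neq\{0_M\}$, $E\neq M$, such that $E\cap N\neq\{0_M\}$ for every nonzero submodule $N$ of $M$. For a prime $p\in R$ and a positive integer $k$, $\mathrm{Ann}_M(p^k)=\{m\in M: p^k m=0\}$. A module is torsion if each of its elements is annihilated by some nonzero element of $R$. *)

(* Defs.v *)
From mathcomp Require Import all_boot all_algebra.
From mathcomp Require Import boolp classical_sets.

Set Implicit Arguments.
Unset Strict Implicit.
Unset Printing Implicit Defensive.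

Import GRing.Theory.
Local Open Scope ring_scope.
Local Open Scope classical_set_scope.

(* Subsets are Prop-valued ([set M]), so that arbitrary submodules and ideals,
   not only the decidable ones, are quantified over. *)
Definition is_submodule (R : pzRingType) (M : lmodType R) (N : set M) : Prop :=
  GRing.submod_closed [in N].

(* [I] is regarded as a subset of [R^o], i.e. of [R] as a module over itself. *)
Definition is_ideal (R : comNzRingType) (I : set R) : Prop :=
  is_submodule (I : set R^o).

Definition is_PID (R : idomainType) : Prop :=
  forall I : set R, is_ideal I ->
    exists g : R, I = [set r * g | r in [set: R]].

Definition divides (R : comNzRingType) (a b : R) : Prop :=
  exists c : R, b = c * a.

Definition prime_element (R : idomainType) (p : R) : Prop :=
  [/\ p != 0, p \isn't a GRing.unit
    & forall a b : R, divides p (a * b) -> divides p a \/ divides p b].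

Definition proper_essential (R : pzRingType) (M : lmodType R) (E : set M)
    : Prop :=
  [/\ is_submodule E, E <> [set 0], E <> [set: M]
    & forall N : set M, is_submodule N -> N <> [set 0] ->
        E `&` N <> [set 0]].

Definition annihilated (R : pzRingType) (M : lmodType R) (r : R) : set M :=
  [set m | r *: m = 0].

Arguments annihilated {R} M r.

Definition is_torsion (R : pzRingType) (M : lmodType R) : Prop :=
  forall m : M, exists2 r : R, r != 0 & r *: m = 0.

(* Main.v *)
(* Both directions reduce to a prime p and Bezout coefficients for p and an
   element prime to p.  If p^j m = 0 but p^i m <> 0 with i >= 1, the elements
   whose p-primary component is killed by p form a proper essential submodule:
   for x <> 0 and k >= 1 least such that p^k s x = 0 for some s prime to p,
   p^(k-1) x is nonzero and lies in it.  Conversely, if E is proper essential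
   and x is not in E, a prime divisor of the generator of (E : x) yields m not in
   E with p m in E; multiplying m by some s prime to p makes it p-primary.  If
   Ann(p^k) = Ann(p) for all k >= 1, then p m = 0, so R m is simple and meets E
   only in 0. *)

Require Import Defs.
From mathcomp Require Import all_boot all_algebra.
From mathcomp Require Import boolp classical_sets.
From mathcomp Require Import ring.

Set Implicit Arguments.
Unset Strict Implicit.
Unset Printing Implicit Defensive.

Import GRing.Theory.
Local Open Scope ring_scope.
Local Open Scope classical_set_scope.

(** * Submodules as Prop-valued subsets *)

Lemma is_submoduleP (R : pzRingType) (M : lmodType R) (N : set M) :
  is_submodule N <->
  N 0 /\ (forall (a : R) (x y : M), N x -> N y -> N (a *: x + y)).
Proof.
split=> [[N0 NL]|[N0 NL]]; split.
- by move: N0; rewrite !inE.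
- by move=> a x y Nx Ny; have := NL a x y; rewrite !inE; apply.
- by rewrite !inE.
- by move=> a x y; rewrite !inE => Nx Ny; apply: NL.
Qed.

Section Submodule.
Variables (R : pzRingType) (M : lmodType R) (N : set M).
Hypothesis subN : is_submodule N.

Lemma submodule0 : N 0. Proof. by case/is_submoduleP: subN. Qed.

Lemma submoduleZ (a : R) (x : M) : N x -> N (a *: x).
Proof.
case/is_submoduleP: subN => N0 NL Nx.
by rewrite -[_ *: _]addr0; apply: NL.
Qed.

Lemma submoduleD (x y : M) : N x -> N y -> N (x + y).
Proof.
case/is_submoduleP: subN => N0 NL Nx Ny.
by rewrite -[x]scale1r; apply: NL.
Qed.

Lemma submodule_neq0 : N <> [set 0] -> exists2 x, N x & x != 0.
Proof.
move=> N_neq0; apply: contrapT => no_x; apply: N_neq0.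
apply/seteqP; split=> [x Nx|_ ->]; last exact: submodule0.
by apply: contrapT => /eqP x0; apply: no_x; exists x.
Qed.

End Submodule.

Lemma cyclic_submodule (R : pzRingType) (M : lmodType R) (m : M) :
  is_submodule [set a *: m | a in [set: R]].
Proof.
apply/is_submoduleP; split=> [|a _ _ [b _ <-] [c _ <-]].
  by exists 0; rewrite ?scale0r.
by exists (a * b + c); rewrite // scalerDl scalerA.
Qed.

(** * Primes and divisibility in a principal ideal domain *)

Lemma prime_not_divides1 (R : idomainType) (p : R) :
  prime_element p -> ~ divides p 1.
Proof.
move=> [_ /negP punit _] [c c1]; apply: punit.
by apply/unitrPr; exists c; rewrite mulrC.
Qed.

Lemma prime_not_dividesM (R : idomainType) (p a b : R) :
  prime_element p -> ~ divides p a -> ~ divides p b -> ~ divides p (a * b).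
Proof. by move=> [_ _ pP] npa npb /pP[]. Qed.

Section PID.
Variable R : idomainType.
Hypothesis hPID : is_PID R.

Lemma pid_ideal_gen (I : set R) :
    I 0 -> (forall a x y, I x -> I y -> I (a * x + y)) ->
  exists2 g, I g & forall x, I x -> divides g x.
Proof.
move=> I0 IL.
have idI : is_ideal I by apply/is_submoduleP; split.
have [g defI] := hPID idI; exists g.
  by rewrite defI; exists 1; rewrite ?mul1r.
by move=> x; rewrite {1}defI => -[c _ <-]; exists c.
Qed.

(** Let [g] generate the ideal spanned by [p] and [s], with [p = c * g]. As [p] is prime, it divides
    [c], which makes [g] a unit, or [g], and then also [s]. *)
Lemma prime_bezout (p s : R) : prime_element p -> ~ divides p s ->
  exists a b, a * p + b * s = 1.
Proof.
move=> pr_p nps; have [p0 _ pP] := pr_p.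
pose I : set R := [set x | exists a b, x = a * p + b * s].
have [||g [a [b defg]] gI] := @pid_ideal_gen I.
- by exists 0, 0; rewrite !mul0r addr0.
- move=> c _ _ [a [b ->]] [a' [b' ->]]; exists (c * a + a'), (c * b + b').
  by ring.
have [c defp] : divides g p by apply: gI; exists 1, 0; ring.
have [e defs] : divides g s by apply: gI; exists 0, 1; ring.
have [|[d defc]|[d defg']] := pP c g.
- by exists 1; rewrite mul1r.
- exists (d * a), (d * b); apply: (mulIf p0).
  rewrite mul1r [RHS]defp {}defc defg; ring.
- by case: nps; exists (e * d); rewrite defs defg'; ring.
Qed.

(** Zorn's lemma gives a maximal ideal containing [g]; its generator is the prime. *)
Lemma exists_prime_divisor (g : R) : g != 0 -> g \isn't a GRing.unit ->
  exists2 p, prime_element p & divides p g.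
Proof.
move=> g0 gunit.
(* The last clause lets the empty set, the union of the empty chain, satisfy
   [P], while every nonempty member of [P] contains [g]. *)
pose P (X : set R) := [/\ forall a x y, X x -> X y -> X (a * x + y),
  ~ X 1 & forall x, X x -> X g].
have [F FP Ftot|A [[AL A1 Ag] Amax]] := @Zorn_bigcup _ P.
  split=> [a x y [X FX Xx] [Y FY Yy]|[X FX X1]|x [X FX Xx]].
  - case: (Ftot _ _ FX FY) => [XY|YX].
      by have [YL _ _] := FP _ FY; exists Y => //; apply: YL => //; apply: XY.
    by have [XL _ _] := FP _ FX; exists X => //; apply: XL => //; apply: YX.
  - by have [_ + _] := FP _ FX; apply.
  - by have [_ _ Xg] := FP _ FX; exists X => //; apply: Xg Xx.
have {}Ag : A g.
  (* If [A] were empty, the multiples of [g] would form a strictly larger member of [P]. *)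
  apply: contrapT => nAg; apply: (Amax [set x | divides g x]).
    split=> [x Ax|gA]; first by case: nAg; apply: Ag Ax.
    by apply/nAg/gA; exists 1; rewrite mul1r.
  split=> [a _ _ [c ->] [d ->]|[c c1]|x _].
  - by exists (a * c + d); ring.
  - by move/negP: gunit; apply; apply/unitrPr; exists c; rewrite mulrC.
  - by exists 1; rewrite mul1r.
have A0 : A 0 by have := AL (-1) _ _ Ag Ag; rewrite mulN1r addNr.
have AM a x : A x -> A (a * x) by move=> Ax; rewrite -[_ * _]addr0; apply: AL.
have [p Ap pA] := pid_ideal_gen A0 AL.
exists p; last exact: pA.
split=> [||a b pab].
- by apply/eqP => p0; have [c defg] := pA _ Ag; rewrite defg p0 mulr0 eqxx in g0.
- by apply/negP => /mulVr p1; apply: A1; rewrite -p1; apply: AM.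
- apply: contrapT => /not_orP[npa npb].
  (* [B] is strictly larger than [A]. It is proper: multiplying [1 = u * p + v * a] by [b] would
     make [p] divide [b]. *)
  pose B : set R := [set x | exists u v, x = u * p + v * a].
  apply: (Amax B).
    split=> [x /pA[c ->]|BA]; first by exists c, 0; rewrite mul0r addr0.
    by apply/npa/pA/BA; exists 0, 1; rewrite mul0r add0r mul1r.
  split=> [c _ _ [u [v ->]] [u' [v' ->]]|[u [v uv1]]|x _].
  + by exists (c * u + u'), (c * v + v'); ring.
  + have [d defab] := pab; apply: npb; exists (u * b + v * d).
    by rewrite -[LHS]mul1r uv1 mulrDl -[v * a * b]mulrA defab; ring.
  + by have [c ->] := pA _ Ag; exists c, 0; rewrite mul0r addr0.
Qed.

(** Stands in for splitting off the powers of [p] from [r], without factorization: [s] generates the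
    ideal of all [x] such that [r] divides some [p ^+ k * x]. *)
Lemma multiple_prime_part (p r : R) : prime_element p -> r != 0 ->
  exists k s, ~ divides p s /\ divides r (p ^+ k * s).
Proof.
move=> pr_p r0; pose I : set R := [set x | exists k, divides r (p ^+ k * x)].
have [||g [k rg] gI] := @pid_ideal_gen I.
- by exists 0, 0; rewrite mulr0 mul0r.
- move=> a x y [k [c defx]] [l [d defy]]; exists (k + l).
  exists (a * p ^+ l * c + p ^+ k * d).
  transitivity (a * p ^+ l * (p ^+ k * x) + p ^+ k * (p ^+ l * y)).
    by rewrite exprD; ring.
  by rewrite defx defy; ring.
have [u defr] : divides g r by apply: gI; exists 0, 1.
(* If [g = h * p], then [h] is in [I] too, so [g] divides [h] and [p] would be a unit. *)
exists k, g; split=> // -[h defg].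
have [v defh] : divides g h.
  by apply: gI; exists k.+1; rewrite exprSr -mulrA [p * h]mulrC -defg.
have h0 : h != 0.
  by apply: contraNneq r0 => h0; rewrite defr defg h0 mul0r mulr0.
apply: (prime_not_divides1 pr_p); exists v; apply: (mulIf h0).
by rewrite mul1r {1}defh defg; ring.
Qed.

(** * Primary components and essential submodules *)

Variable M : lmodType R.
Implicit Types (E : set M) (m x : M) (p s : R).

Lemma submodule_coprime_scale E p s m : is_submodule E -> prime_element p ->
  ~ divides p s -> E (p *: m) -> E (s *: m) -> E m.
Proof.
move=> subE pr_p nps Epm Esm; have [a [b ab1]] := prime_bezout pr_p nps.
rewrite -[m]scale1r -ab1 scalerDl -!scalerA.
by apply: submoduleD => //; apply: submoduleZ.
Qed.

(** As [s] kills [m], Bezout gives [m = (a * p) *: m]; iterating [n] times brings in [p ^+ n]. *)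
Lemma coprime_annihilated0 p s n m : prime_element p -> ~ divides p s ->
  p ^+ n *: m = 0 -> s *: m = 0 -> m = 0.
Proof.
move=> pr_p nps pm sm; have [a [b ab1]] := prime_bezout pr_p nps.
have defm : m = (a * p) *: m.
  by rewrite -{1}[m]scale1r -ab1 scalerDl -[(b * s) *: m]scalerA sm scaler0 addr0.
have {}defm k : m = (a * p) ^+ k *: m.
  by elim: k => [|k IHk]; rewrite ?scale1r // exprSr -scalerA -defm.
by rewrite (defm n) exprMn -scalerA pm scaler0.
Qed.

(* The elements whose p-primary component is killed by p. *)
Definition prime_socle p : set M :=
  [set x | exists2 s, ~ divides p s & (p * s) *: x = 0].

Lemma prime_socle_submodule p : prime_element p ->
  is_submodule (prime_socle p).
Proof.
move=> pr_p; apply/is_submoduleP; split.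
  by exists 1; [exact: prime_not_divides1|rewrite scaler0].
move=> a x y [s nps sx] [t npt ty]; exists (s * t).
  exact: prime_not_dividesM.
rewrite scalerDr scalerA.
have -> : p * (s * t) * a = (a * t) * (p * s) by ring.
have -> : p * (s * t) = s * (p * t) by ring.
by rewrite -(scalerA (a * t)) sx -(scalerA s) ty !scaler0 addr0.
Qed.

Lemma prime_socle_essential p (N : set M) : is_torsion M -> prime_element p ->
  is_submodule N -> N <> [set 0] -> prime_socle p `&` N <> [set 0].
Proof.
move=> torM pr_p subN /(submodule_neq0 subN)[x Nx x0].
suff [k [y0 [s nps sy]]] : exists k, p ^+ k *: x <> 0 /\ prime_socle p (p ^+ k *: x).
  move=> /seteqP[sub0 _]; apply: y0; apply: sub0.
  by split; [exists s|apply: submoduleZ].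
have [r r0 rx] := torM x.
have [k [s [nps [c defc]]]] := multiple_prime_part pr_p r0.
have {r r0 rx c defc} : p ^+ k *: (s *: x) = 0.
  by rewrite scalerA defc -scalerA rx scaler0.
elim: k => [|k IHk] ksx.
  exists 0; rewrite scale1r; split; first exact/eqP.
  by exists s => //; rewrite -scalerA -[s *: x]scale1r ksx scaler0.
(* If this multiple vanishes, the exponent drops, with the same [s]; otherwise it is the element
   sought, since [p * s] kills it. *)
have [y0|y0] := pselect (p ^+ k *: x = 0).
  by apply: IHk; rewrite scalerA mulrC -scalerA y0 scaler0.
exists k; split=> //; exists s => //.
by rewrite -ksx !scalerA exprS; congr (_ *: _); ring.
Qed.

(** Both [p ^+ j] and [s] kill [p ^+ i *: m]; for [s], the positive exponent [i] supplies the factor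
    [p] of [p * s]. *)
Lemma prime_socle_proper p i j m : prime_element p -> (0 < i)%N ->
  p ^+ j *: m = 0 -> p ^+ i *: m <> 0 -> ~ prime_socle p m.
Proof.
move=> pr_p i0 jm im [s nps sm]; apply: im.
apply: (coprime_annihilated0 (n := j) pr_p nps).
  by rewrite scalerA mulrC -scalerA jm scaler0.
rewrite scalerA -(prednK i0) exprS.
have -> : s * (p * p ^+ i.-1) = p ^+ i.-1 * (p * s) by ring.
by rewrite -scalerA sm scaler0.
Qed.

Lemma essential_prime_primary E : is_torsion M -> is_submodule E ->
  E <> [set: M] ->
  exists p k m, [/\ prime_element p, p ^+ k *: m = 0, E (p *: m) & ~ E m].
Proof.
move=> torM subE /eqP/setTPn[x nEx].
pose I : set R := [set r | E (r *: x)].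
have [||g Ig gI] := @pid_ideal_gen I.
- by rewrite /I/= scale0r; apply: submodule0.
- move=> a r t Ir It; rewrite /I/= scalerDl -scalerA.
  by apply: submoduleD => //; apply: submoduleZ.
have g0 : g != 0.
  have [r r0 rx] := torM x.
  have [c defr] : divides g r by apply: gI; rewrite /I/= rx; apply: submodule0.
  by apply: contraNneq r0 => g0; rewrite defr g0 mulr0.
have gunit : g \isn't a GRing.unit.
  apply/negP => /mulVr g1; apply: nEx.
  by rewrite -[x]scale1r -g1 -scalerA; apply: submoduleZ.
have [p pr_p [h defg]] := exists_prime_divisor g0 gunit.
have h0 : h != 0 by apply: contraNneq g0 => h0; rewrite defg h0 mul0r.
(* Otherwise [g = h * p] would divide [h], and [p] would be a unit. *)
have nEhx : ~ E (h *: x).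
  move=> /gI[v defh]; apply: (prime_not_divides1 pr_p); exists v.
  by apply: (mulIf h0); rewrite mul1r {1}defh defg; ring.
have Ephx : E (p *: (h *: x)) by rewrite scalerA mulrC -defg.
have [r r0 rx] := torM (h *: x).
have [k [s [nps [c defc]]]] := multiple_prime_part pr_p r0.
exists p, k, (s *: (h *: x)); split=> //.
- by rewrite (scalerA (p ^+ k)) defc -scalerA rx scaler0.
- by rewrite (scalerA p) mulrC -scalerA; apply: submoduleZ.
- by move=> Esx; apply: nEhx; exact: submodule_coprime_scale subE pr_p nps Ephx Esx.
Qed.

(** For [a *: m] in [E], either [p] divides [a] and [a *: m = 0], or Bezout puts [m] in [E]. *)
Lemma prime_cyclic_disjoint E p m : is_submodule E -> prime_element p ->
  p *: m = 0 -> ~ E m -> E `&` [set a *: m | a in [set: R]] = [set 0].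
Proof.
move=> subE pr_p pm nEm; apply/seteqP; split=> [y [+ [a _ defy]]|_ ->].
  rewrite -{}defy => Eam; have [[c defa]|npa] := pselect (divides p a).
    by rewrite /= defa -scalerA pm scaler0.
  case: nEm; apply: (submodule_coprime_scale subE pr_p npa _ Eam).
  by rewrite pm; apply: submodule0.
by split; [|exists 0; rewrite ?scale0r]; rewrite //; apply: submodule0.
Qed.

End PID.

Arguments prime_socle {R} M p.

Theorem theorem2p7 (R : idomainType) (hPID : is_PID R)
    (hnf : ~ GRing.field_axiom R) (M : lmodType R) (hM : is_torsion M) :
  (exists E : set M, proper_essential E) <->
  (exists (p : R) (i j : nat),
    [/\ prime_element p, (0 < i)%N, (i < j)%N
      & annihilated M (p ^+ i) `<` annihilated M (p ^+ j)]).
Proof.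
split=> [[E [subE _ EnT Eess]]|[p [i [j [pr_p i0 _ [_ /nonsubset[m [jm im]]]]]]]].
  have [p [k [m [pr_p km _ nEm]]]] := essential_prime_primary hPID hM subE EnT.
  have m0 : m <> 0 by move=> m0; apply: nEm; rewrite m0; apply: submodule0.
  have pm : p *: m <> 0.
    move=> pm; apply: (Eess _ (cyclic_submodule m)).
      by move=> /seteqP[/(_ m) + _] => /(_ _)/m0; apply; exists 1; rewrite ?scale1r.
    exact: (prime_cyclic_disjoint hPID subE pr_p pm nEm).
  (* [k = 0] would give [m = 0], and [k = 1] would give [p *: m = 0]. *)
  have k1 : (1 < k)%N.
    by case: k km => [|[|//]]; rewrite ?scale1r ?expr1.
  exists p, 1, k; split=> //; split=> [x|/(_ m km)].
    rewrite /annihilated/= expr1 => px.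
    by rewrite -(prednK (ltnW k1)) exprSr -scalerA px scaler0.
  by rewrite /annihilated/= expr1.
have Eess N := @prime_socle_essential R hPID M p N hM pr_p.
have nEm := prime_socle_proper hPID pr_p i0 jm im.
exists (prime_socle M p); split.
- exact: prime_socle_submodule.
(* Essentiality is applied to the whole module, which is nonzero as it contains [m]. *)
- rewrite -[prime_socle M p]setIT; apply: Eess.
    by apply/is_submoduleP.
  by move=> /seteqP[/(_ m I) m0 _]; apply: im; rewrite m0 /annihilated/= scaler0.
- by move=> ET; apply: nEm; rewrite ET.
- exact: Eess.
Qed.
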